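(* Let $\mathcal F$ be a finite family of connected bounded open sets in $\mathbb R^2$, and let $n\le m$ be positive integers. Then at least one of the following holds. (1) $\mathcal F$ can be cut by a family consisting of $m$ horizontal and $n$ vertical lines. (2) For any $n+1$ positive integers $a_1,\ldots,a_n,a_{n+1}$ with $\sum_{i=1}^{n+1}a_i=m+1$ there exist a subfamily $\{X_1,\ldots,X_{m+1}\}\subseteq\mathcal F$ and a map $\sigma:[m+1]\to[n+1]$ such that: $|\sigma^{-1}(i)|=a_i$ for all $i\in[n+1]$; the projections of $X_i$ and $X_j$ to the $y$ axis do not intersect whenever $i\neq j$; and the projections of $X_i$ and $X_j$ to the $x$ axis do not intersect whenever $\sigma(i)\neq\sigma(j)$.
   Context: $[n]=\{1,2,\ldots,n\}$. A family $\mathcal L$ of lines in $\mathbb R^2$ cuts a family $\mathcal F$ of subsets of $\mathbb R^2$ if for every $F\in\mathcal F$ there is some $l\in\mathcal L$ with $F\cap l\neq\emptyset$. A coordinate system in $\mathbb R^2$ is fixed; a line is horizontal if it is parallel to the $x$ axis and vertical if it is parallel to the $y$ axis. Connected sets are understood to be nonempty. *)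

(* Defs.v *)
From mathcomp Require Import all_boot all_order all_algebra.
From mathcomp Require Import all_classical all_reals all_analysis.
Import Order.TTheory GRing.Theory Num.Theory.
Import numFieldNormedType.Exports.

Set Implicit Arguments.
Unset Strict Implicit.
Unset Printing Implicit Defensive.

Local Open Scope classical_set_scope.
Local Open Scope ring_scope.

(* The plane is [R * R] with the library's product topology and norm; the
   first component is the x coordinate, the second one the y coordinate. *)

(* The x axis itself counts as horizontal, and the y axis as vertical. *)
Definition horizontal_line (R : realType) (l : set (R * R)) : Prop :=
  exists c : R, l = [set p | p.2 = c].

Definition vertical_line (R : realType) (l : set (R * R)) : Prop :=
  exists c : R, l = [set p | p.1 = c].

Definition cuts (R : realType) (L F : set (set (R * R))) : Prop :=
  forall X, F X -> exists2 l, L l & X `&` l !=set0.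

(* A set of exactly m (distinct) horizontal and n (distinct) vertical lines. *)
Definition lines_family (R : realType) (m n : nat)
    (L : set (set (R * R))) : Prop :=
  exists H V : set (set (R * R)),
    [/\ L = H `|` V,
        (H #= `I_m)%card /\ H `<=` @horizontal_line R
      & (V #= `I_n)%card /\ V `<=` @vertical_line R].

(* The library's [connected] also holds of the empty set, whence the separate
   nonemptiness requirement. *)
Definition connected_bounded_open (R : realType) (X : set (R * R)) : Prop :=
  [/\ X !=set0, connected X, bounded_set X & open X].

(* Main.v *)
(* A set in F may be replaced by its bounding open rectangle: being connected,
   it misses a horizontal or vertical line iff its projection does.  A point z
   of a simplex with m+1 + n+1 coordinates encodes m horizontal and n vertical
   lines, the coordinates being the widths of the strips they bound.  To each
   cell (i, j) of the resulting grid attach a weight that is positive iff some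
   rectangle fits in the cell (up to a small tolerance).  If no choice of lines
   cuts F, the weights never all vanish; their row and column sums vanish on
   the faces where the strip is degenerate, so by a KKM-type argument they
   become proportional to (1, ..., 1; a_1, ..., a_{n+1}) up to an arbitrarily
   small error.  Hall's theorem then extracts from the support of that matrix
   an assignment of rows to columns using column j exactly a_j times, which is
   sigma; one rectangle in each selected cell gives the X_i.  The KKM step is
   derived from the combinatorial lemma of Scarf on families of linear orders. *)

Require Import Defs.
From mathcomp Require Import all_boot all_order all_algebra.
From mathcomp Require Import zify ring lra.
Import Order.TTheory GRing.Theory Num.Theory.

Set Implicit Arguments.
Unset Strict Implicit.
Unset Printing Implicit Defensive.

(** * Scarf's lemma on dominated sets in a family of linear orders *)

Section Scarf.
Variables (V I : finType) (rk : I -> V -> nat).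
Hypothesis rk_inj : forall i, injective (rk i).

(** Scarf's domination: no point of [V] exceeds the minimum of [S] in every order. In particular
    each point of a dominated set is its lowest one in some order. *)
Definition dominated (S : {set V}) :=
  [forall y, exists i, forall s in S, rk i y <= rk i s].

Lemma dominatedP (S : {set V}) :
  reflect (forall y, exists i, forall s, s \in S -> rk i y <= rk i s)
          (dominated S).
Proof.
apply: (iffP forallP) => h y.
  by have /existsP[i /forall_inP hi] := h y; exists i.
by have [i hi] := h y; apply/existsP; exists i; apply/forall_inP.
Qed.

Lemma dominatedS (S S' : {set V}) :
  S' \subset S -> dominated S -> dominated S'.
Proof.
move=> /subsetP sub /dominatedP h; apply/dominatedP => y.
by have [i hi] := h y; exists i => s /sub; apply: hi.
Qed.

(* For a dominated S with #|I| - 1 elements ("door"), the map [lowest] from I onto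
   S has exactly one collision i, i'.  A dominated y |: S ("room") is obtained
   only by letting y take over the role of the lowest point for i or for i',
   and then y is the topmost element of [above i], resp. [above i']. *)
Section Door.
Variables (S : {set V}) (s0 : V).
Hypotheses (s0S : s0 \in S) (domS : dominated S) (cardS : #|S|.+1 = #|I|).

Definition lowest i := [arg min_(s < s0 in S) rk i s].

Lemma lowest_in i : lowest i \in S.
Proof. by rewrite /lowest; case: arg_minnP. Qed.

Lemma lowest_le i s : s \in S -> rk i (lowest i) <= rk i s.
Proof. by rewrite /lowest; case: arg_minnP => // t _; apply. Qed.

Lemma lowest_eq i s : s \in S -> (forall t, t \in S -> rk i s <= rk i t) ->
  lowest i = s.
Proof.
move=> sS h; apply/(@rk_inj i)/eqP; rewrite eqn_leq lowest_le //=.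
exact/h/lowest_in.
Qed.

Lemma lowest_surj s : s \in S -> exists i, lowest i = s.
Proof.
move=> sS; have /dominatedP/(_ s)[i hi] := domS.
by exists i; apply: lowest_eq.
Qed.

Lemma lowest_collision : exists i i', i != i' /\ lowest i = lowest i'.
Proof.
have : ~ injective lowest.
  move=> inj; have := card_imset predT inj.
  have -> : lowest @: predT = S.
    apply/setP => s; apply/imsetP/idP => [[i _ ->]|/lowest_surj[i <-]].
      exact: lowest_in.
    by exists i.
  by rewrite -[#|predT|]/#|I| -cardS => /eqP; rewrite ltn_eqF.
move/(introN (injectiveP _))/injectivePn => [i [i' ne eq]].
by exists i, i'.
Qed.

Definition above k := [set z | [forall (j | j != k), rk j (lowest j) < rk j z]].

Lemma aboveP k z : reflect (forall j, j != k -> rk j (lowest j) < rk j z) (z \in above k).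
Proof. by rewrite inE; apply: forall_inP. Qed.

Definition tops k := [set y in above k | [forall z in above k, rk k z <= rk k y]].

Lemma topsP k y : reflect (y \in above k /\ forall z, z \in above k -> rk k z <= rk k y) (y \in tops k).
Proof.
rewrite [_ \in tops k]in_set; apply: (iffP andP) => -[-> h]; split => //; first exact/forall_inP.
exact/forall_inP.
Qed.

Lemma card_tops k : #|tops k| = (above k != set0).
Proof.
have [A0|/set0Pn[z zA]] := eqVneq (above k) set0.
  by apply/eqP; rewrite cards_eq0; apply/eqP/setP => y; rewrite /tops A0 !inE.
apply/eqP/cards1P.
case: (@arg_maxnP _ z (mem (above k)) (rk k) zA) => y yA ymax.
exists y; apply/setP => w; rewrite inE; apply/topsP/eqP => [[wA wmax]|->].
  by apply/(@rk_inj k)/eqP; rewrite eqn_leq wmax // andbT; apply: ymax.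
by split.
Qed.

Lemma above_low k y : y \in above k -> rk k y <= rk k (lowest k).
Proof.
move=> /aboveP yA; have /dominatedP/(_ y)[j hj] := domS.
have [<-|/yA] := eqVneq j k; first exact/hj/lowest_in.
by rewrite ltnNge hj ?lowest_in.
Qed.

(** By the collision every point of [S] is lowest in an order other than [k], so [y] is not one of
    them. A point of [above k] is dominated in order [k], by maximality of [y]; any other point is
    dominated in an order where [y] lies above the old minimum. *)
Lemma tops_room k k' y : k' != k -> lowest k = lowest k' -> y \in tops k ->
  (y \notin S) && dominated (y |: S).
Proof.
move=> ne eqk /topsP[yA ymax]; apply/andP; split.
  apply/negP => /lowest_surj[j ej].
  have {ej} [j' [nj ej]] : exists j', j' != k /\ lowest j' = y.
    have [eq|nj] := eqVneq j k; last by exists j.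
    by exists k'; split=> //; rewrite -eqk -eq.
  by have := elimT (aboveP _ _) yA j' nj; rewrite ej ltnn.
apply/dominatedP => z; have [zA|/negP zA] := boolP (z \in above k).
  exists k => s /setU1P[->|sS]; first exact: ymax.
  exact: leq_trans (above_low zA) (lowest_le _ sS).
have /existsP[j /andP[nj hj]] : [exists j, (j != k) && (rk j z <= rk j (lowest j))].
  apply: contra_notT zA => /existsPn h; apply/aboveP => j nj.
  by have := h j; rewrite nj /= -ltnNge.
exists j => s /setU1P[->|sS]; last exact: leq_trans (lowest_le _ sS).
by apply: leq_trans hj _; apply: ltnW; move/aboveP: yA; apply.
Qed.


(** [y] is lowest in some order [k], and each [s] in [S] stays lowest in an order [f s] different
    from [k]. By counting, [f] is onto the orders other than [k], where [lowest] is therefore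
    injective; so [k] is [i] or [i']. *)
Lemma room_tops i i' y : i != i' -> lowest i = lowest i' ->
  y \notin S -> dominated (y |: S) -> (y \in tops i) || (y \in tops i').
Proof.
move=> ne eqi yS /dominatedP dom.
have [k hk] := dom y.
have hkS s : s \in S -> rk k y <= rk k s by move=> sS; apply: hk; rewrite setU1r.
pose good (s : V) (j : I) := [forall t in y |: S, rk j s <= rk j t].
have goodE s : s \in S -> exists j, good s j.
  by move=> sS; have [j hj] := dom s; exists j; apply/forall_inP.
pose f s := odflt k [pick j | good s j].
have fP s : s \in S -> good s (f s).
  by move=> /goodE[j hj]; rewrite /f; case: pickP => // /(_ j); rewrite hj.
have lowf s : s \in S -> lowest (f s) = s.
  move=> sS; apply: lowest_eq => // t tS.
  by move/forall_inP: (fP s sS); apply; rewrite setU1r.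
have fy s : s \in S -> rk (f s) s <= rk (f s) y.
  by move=> sS; move/forall_inP: (fP s sS); apply; rewrite setU11.
have fnk s : s \in S -> f s != k.
  move=> sS; apply: contraNneq yS => fk.
  have /(@rk_inj k) <- // : rk k s = rk k y.
  by apply/eqP; rewrite eqn_leq hkS // andbT -{1 2}fk fy.
have imf : f @: S = [set~ k].
  apply/eqP; rewrite eqEcard; apply/andP; split.
    by apply/subsetP => _ /imsetP[s sS ->]; rewrite !inE fnk.
  rewrite cardsC1 -cardS card_in_imset // => s t sS tS eqf.
  by rewrite -(lowf s) // -(lowf t) // eqf.
have preim j : j != k -> exists2 s, s \in S & j = f s.
  by move=> nj; apply/imsetP; rewrite imf !inE.
have yA : y \in above k.
  apply/aboveP => j /preim[s sS ->]; rewrite lowf // ltn_neqAle fy // andbT.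
  by rewrite (inj_eq (@rk_inj _)); apply: contraNneq yS => <-.
have ytop : y \in tops k.
  apply/topsP; split=> // z /aboveP zA; have [j hj] := dom z.
  have [<-|/zA] := eqVneq j k; first by apply: hj; rewrite setU11.
  by rewrite ltnNge hj // setU1r // lowest_in.
have [<-|nik] := eqVneq k i; first by rewrite ytop.
have [<-|nik'] := eqVneq k i'; first by rewrite ytop orbT.
have [s sS es] := preim i ltac:(by rewrite eq_sym).
have [s' sS' es'] := preim i' ltac:(by rewrite eq_sym).
have eqs : s = s' by rewrite -(lowf s sS) -(lowf s' sS') -es -es'.
by move: ne; rewrite es es' eqs eqxx.
Qed.

Lemma tops_disjoint i i' : i != i' -> lowest i = lowest i' -> [disjoint tops i & tops i'].
Proof.
move=> ne eqi; apply/pred0P => y /=; apply/negP => /andP[/topsP[yA _] /topsP[/aboveP yA' _]].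
by have := above_low yA; rewrite leqNgt yA'.
Qed.

Lemma card_rooms i i' : i != i' -> lowest i = lowest i' ->
  #|[set y | (y \notin S) && dominated (y |: S)]| = (above i != set0) + (above i' != set0).
Proof.
move=> ne eqi; rewrite -!card_tops -cardsUI.
have -> : tops i :&: tops i' = set0.
  by apply/eqP; rewrite setI_eq0; apply: tops_disjoint.
rewrite cards0 addn0; apply: eq_card => y; rewrite [in LHS]inE [in RHS]in_setU.
apply/andP/orP => [[yS dom]|[] yt]; first exact/orP/room_tops.
  by apply/andP; apply: tops_room eqi yt; rewrite eq_sym.
by apply/andP; apply: tops_room (esym eqi) yt.
Qed.
End Door.

(* The [e i] are slack elements: e i is the bottom of the i-th order and lies
   above all non-slack elements in the other ones. *)
Variables (e : I -> V) (c : V -> I).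
Hypothesis I_gt1 : 1 < #|I|.
Hypothesis e_min : forall i v, rk i (e i) <= rk i v.
Hypothesis e_max : forall i j v, j != i -> v \notin codom e -> rk i v < rk i (e j).
Hypothesis cK : cancel e c.

Lemma e_inj : injective e. Proof. exact: can_inj cK. Qed.

Lemma e_lt i v : v \notin codom e -> rk i (e i) < rk i v.
Proof.
move=> ve; rewrite ltn_neqAle e_min andbT (inj_eq (@rk_inj i)).
by apply: contraNneq ve => <-; apply: codom_f.
Qed.

(** Of the two sets counted by [card_rooms], [above i0] contains [v]. The other, [above k], is
    empty: exceeding [e k] in order [i0] forces a slack element, and no [e l] exceeds all the minima
    required. *)
Lemma slack_rooms (i0 : I) (v : V) : v \notin codom e ->
  let D := e @: [set~ i0] in
  dominated D /\ #|[set y | (y \notin D) && dominated (y |: D)]| = 1.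
Proof.
move=> ve D.
have eD j : (e j \in D) = (j != i0) by rewrite mem_imset ?inE //; apply: e_inj.
have domD : dominated D.
  apply/dominatedP => y; have [/codomP[j ->]|ye] := boolP (y \in codom e).
    have [->|nj] := eqVneq j i0; first by exists i0 => s _; apply: e_min.
    by exists j => s _; apply: e_min.
  by exists i0 => _ /imsetP[j + ->]; rewrite !inE => nj; apply/ltnW/e_max.
split=> //.
have cardD : #|D|.+1 = #|I|.
  by rewrite card_imset ?cardsC1 ?prednK //; [apply: ltnW | apply: e_inj].
have [s0 s0D] : exists s0, s0 \in D.
  by apply/set0Pn; rewrite -card_gt0 -ltnS cardD.
have lowE j : j != i0 -> lowest D s0 j = e j.
  by move=> nj; apply: lowest_eq => //; rewrite eD.
have [k nk ek] : exists2 k, k != i0 & lowest D s0 i0 = lowest D s0 k.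
  have [i [i' [ne eqi]]] := lowest_collision s0D domD cardD.
  have [ii|ni] := eqVneq i i0; first by exists i'; [rewrite eq_sym -ii | rewrite -ii].
  have [ii'|ni'] := eqVneq i' i0; first by exists i => //; rewrite -ii'.
  move: eqi; rewrite (lowE _ ni) (lowE _ ni') => eqi.
  by move: ne; rewrite (e_inj eqi) eqxx.
rewrite (card_rooms s0D domD cardD _ ek); last by rewrite eq_sym.
have -> : above D s0 i0 != set0.
  by apply/set0Pn; exists v; apply/aboveP => j nj; rewrite lowE // e_lt.
suff -> : above D s0 k = set0 by rewrite eqxx.
apply/setP => z; rewrite in_set0; apply/negP => /aboveP zA.
have z0 := zA i0 ltac:(by rewrite eq_sym).
have [/codomP[l zl]|ze] := boolP (z \in codom e); last first.
  by move: z0; rewrite ek lowE // ltnNge ltnW // e_max.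
have [l0|nl] := eqVneq l i0; first by move: z0; rewrite zl l0 ltnNge e_min.
have [lk|/zA] := eqVneq l k; first by move: z0; rewrite ek lowE // zl lk ltnn.
by rewrite lowE // zl ltnn.
Qed.

(** [e k] exceeds [v], hence the minimum of [D], in every order other than [k], so both sets [above]
    are nonempty. *)
Lemma inner_rooms (D : {set V}) (v : V) : v \in D -> v \notin codom e ->
  dominated D -> #|D|.+1 = #|I| ->
  #|[set y | (y \notin D) && dominated (y |: D)]| = 2.
Proof.
move=> vD ve domD cardD.
have [i [i' [ne eqi]]] := lowest_collision vD domD cardD.
rewrite (card_rooms vD domD cardD ne eqi).
suff nz k : above D v k != set0 by rewrite !nz.
apply/set0Pn; exists (e k); apply/aboveP => j nj.
apply: leq_ltn_trans (lowest_le vD j vD) _.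
by apply: e_max ve; rewrite eq_sym.
Qed.

(** If deleting [s] leaves each colour but [i0] exactly once, then [s] shares its colour with a
    single [s'], and deleting [s'] is the only other possibility. The number is 0 or 2. *)
Lemma even_doors (i0 : I) (S : {set V}) : #|S| = #|I| -> c @: S != setT ->
  ~~ odd #|[set s in S | c @: (S :\ s) == [set~ i0]]|.
Proof.
move=> cardS nT; have [->|/set0Pn[s]] := eqVneq [set s in S | c @: (S :\ s) == [set~ i0]] set0.
  by rewrite cards0.
rewrite inE => /andP[sS /eqP cs].
have inj : {in S :\ s &, injective c}.
  apply/imset_injP; rewrite cs cardsC1 -cardS; apply/eqP.
  by rewrite (cardsD1 s S) sS.
have nc : c s != i0.
  apply: contraNneq nT => cs0; rewrite -(setD1K sS) imsetU1 cs cs0.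
  by apply/eqP/setP => x; rewrite !inE orbN.
have : c s \in c @: (S :\ s) by rewrite cs !inE.
case/imsetP => s' s'S eqc.
have [ns' s'S'] : s' != s /\ s' \in S by move: s'S; rewrite !inE => /andP.
suff -> : [set t in S | c @: (S :\ t) == [set~ i0]] = [set s; s'].
  by rewrite cards2 eq_sym ns'.
apply/setP => t; rewrite in_set in_set2; apply/andP/orP => [[tS /eqP ct]|[]/eqP->].
- apply/orP; apply: contraT; rewrite negb_or => /andP[ts ts'].
  have tSs : t \in S :\ s by rewrite !inE ts.
  have nt0 : c t != i0.
    have : c t \in c @: (S :\ s) by apply: imset_f.
    by rewrite cs !inE.
  have : c t \in c @: (S :\ t) by rewrite ct !inE.
  case/imsetP => u; rewrite !inE => /andP[ut uS] cu.
  have [us|us] := eqVneq u s.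
    by move: ts'; rewrite (inj t s') ?eqxx // cu us.
  by move: ut; rewrite (inj u t) ?eqxx // !inE us.
- by rewrite cs.
split=> //; rewrite -cs; apply/eqP.
have SsE : S :\ s = s' |: (S :\ s :\ s') by rewrite setD1K.
have Ss'E : S :\ s' = s |: (S :\ s :\ s').
  apply/setP => x; rewrite !inE; have [->|//] := eqVneq x s.
  by rewrite eq_sym ns'.
by rewrite Ss'E [in RHS]SsE !imsetU1 eqc.
Qed.

(* Parity: every door coloured [set~ i0] lies in two rooms, except the all-slack
   one which lies in one room, while a room that is not fully coloured has an
   even number of such doors. *)
Theorem scarf (v : V) : v \notin codom e ->
  exists S, dominated S /\ c @: S = setT.
Proof.
move=> ve; have /card_gt0P[i0 _] := ltnW I_gt1.
pose room S := dominated S && (#|S| == #|I|).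
pose typed (S : {set V}) (s : V) := (s \in S) && (c @: (S :\ s) == [set~ i0]).
have [/existsP[S /and3P[dS _ /eqP cS]]|/existsPn noroom] :=
  boolP [exists S : {set V}, [&& dominated S, #|S| == #|I| & c @: S == setT]].
  by exists S.
(* Incidences of doors and rooms, listed by rooms in [P] and by doors in [Q]; deleting the marked
   point is the bijection. *)
pose P := [set p : {set V} * V | room p.1 && typed p.1 p.2].
pose door (D : {set V}) := [&& dominated D, #|D|.+1 == #|I| & c @: D == [set~ i0]].
pose Q := [set p : {set V} * V | door p.1 && ((p.2 \notin p.1) && dominated (p.2 |: p.1))].
have cardE (X : {set {set V} * V}) (f : pred {set V}) (g : {set V} -> pred V) :
    X = [set p | f p.1 && g p.1 p.2] -> odd #|X| = odd (\sum_(S | f S) #|[set s | g S s]|).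
  move=> ->; congr odd; rewrite -sum1dep_card -(pair_big_dep f g (fun _ _ => 1)) /=.
  by apply: eq_bigr => S _; rewrite sum1dep_card.
have PQ : #|P| = #|Q|.
  pose f (p : {set V} * V) := (p.1 :\ p.2, p.2).
  have injf : {in P &, injective f}.
    move=> [S s] [S' s'] /=; rewrite !inE /= => /andP[_ /andP[sS _]] /andP[_ /andP[s'S _]].
    by case=> eq es; rewrite -(setD1K sS) eq es setD1K.
  rewrite -(card_in_imset injf); apply: eq_card => -[D y]; apply/imsetP/idP.
    case=> -[S s]; rewrite !inE /= => /andP[/andP[dS cS] /andP[sS ct]] [-> ->].
    rewrite /door ct setD1K // dS !inE eqxx /= !andbT.
    rewrite (dominatedS (subD1set _ _) dS) /=.
    by move: cS; rewrite (cardsD1 s) sS.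
  rewrite inE /= => /andP[/and3P[dD cD ct] /andP[yD dyD]].
  exists (y |: D, y); last by rewrite /f /= setU1K.
  by rewrite inE /= /room /typed dyD cardsU1 yD cD setU11 setU1K.
have : odd #|P| = false.
  rewrite (cardE P room typed erefl); apply/negbTE.
  elim/big_rec: _ => // S x /andP[dS cS] ex.
  rewrite oddD (negbTE ex) addbF.
  have := @even_doors i0 S (eqP cS).
  rewrite /typed; apply.
  by have := noroom S; rewrite dS cS.
rewrite PQ (cardE Q door (fun D y => (y \notin D) && dominated (y |: D)) erefl).
have [dD cD1] := slack_rooms i0 ve.
pose D0 := e @: [set~ i0].
have D0door : door D0.
  rewrite /door dD card_imset ?cardsC1 ?prednK ?eqxx //=; [|exact: ltnW|exact: e_inj].
  rewrite -imset_comp (eq_imset (g := id)) ?imset_id //.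
rewrite (bigD1 D0) //= oddD cD1 /=.
have -> : odd (\sum_(S | door S && (S != D0)) #|[set s | (s \notin S) && dominated (s |: S)]|) = false.
  apply/negbTE; elim/big_rec: _ => // D x /andP[/and3P[dD' /eqP cD' /eqP ct] nD] ex.
  rewrite oddD (negbTE ex) addbF.
  have [/exists_inP[w wD we]|/exists_inPn h] := boolP [exists w in D, w \notin codom e].
    by rewrite (inner_rooms wD we dD' cD').
  (* A door made of slack elements only, with all colours but [i0], must be [D0]. *)
  case/negP: nD; rewrite eqEcard; apply/andP; split.
    apply/subsetP => w wD; have := h w wD; rewrite negbK => /codomP[j ew].
    rewrite ew imset_f // -(cK j) -ew -ct; exact: imset_f.
  by rewrite card_imset ?cardsC1 -?cD' //; apply: e_inj.
by [].
Qed.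
End Scarf.

(** * A colouring lemma for the grid points of a simplex *)

(** Scarf's lemma is applied to the grid points, ordered by each coordinate in turn, together with
    one slack element per colour. The grid points of the resulting set are close together, and a
    colour whose slack element occurs in the set has a small coordinate. *)
Lemma grid_colour (I : finType) (N : nat) (c : {ffun I -> 'I_N.+1} -> I) :
  1 < #|I| ->
  exists2 y : {ffun I -> 'I_N.+1}, \sum_i y i = N &
    forall i, y i <= #|I| \/
      exists x : {ffun I -> 'I_N.+1},
        [/\ \sum_i x i = N, c x = i &
            \sum_j ((x j - y j) + (y j - x j)) <= #|I|.*2].
Proof.
move=> I_gt1; have /card_gt0P[i1 _] := ltnW I_gt1.
pose T0 := {x : {ffun I -> 'I_N.+1} | \sum_i (x i : nat) == N}.
pose t := #|{: T0}|.
have mkT (y : I -> nat) : \sum_i y i = N -> exists x : T0, forall i, val x i = y i :> nat.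
  move=> sy; have yN i : y i < N.+1 by rewrite ltnS -sy (bigD1 i) //= leq_addr.
  pose x := [ffun i => Ordinal (yN i)].
  have sx : \sum_i (x i : nat) == N by rewrite -[X in _ == X]sy; apply/eqP/eq_bigr => i _; rewrite ffunE.
  by exists (exist _ x sx) => i; rewrite /= ffunE.
(* Ties between equal coordinates are broken by [enum_rank]. The successor reserves rank 0 for the
   slack of the order itself; the other slacks start above [N.+1 * t]. *)
pose rk i (v : T0 + I) := match v with
  | inl x => (val x i * t + enum_rank x).+1
  | inr j => if j == i then 0 else (N.+1 * t + enum_rank j).+1 end.
have rkx i x : rk i (inl x) <= N.+1 * t.
  have := ltn_ord (enum_rank x); have := ltn_ord (val x i); rewrite /= -/t => h h'.
  apply: leq_trans (leq_mul h (leqnn t)); by rewrite mulSn -addnS addnC leq_add2r.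
have rk_inj i : injective (rk i).
  have lr x j : rk i (inl x) != rk i (inr j).
    rewrite neq_ltn; apply/orP; have [->|nj] := eqVneq j i.
      by right; rewrite /= eqxx.
    left; apply: leq_ltn_trans (rkx i x) _.
    by rewrite /= (negbTE nj) ltnS leq_addr.
  move=> [x|j] [x'|j'].
  - move=> /= [] /(congr1 (modn^~ t)); rewrite !modnMDl !modn_small ?ltn_ord //.
    by move=> /val_inj/enum_rank_inj ->.
  - by move=> eq; have := lr x j'; rewrite eq eqxx.
  - by move=> eq; have := lr x' j; rewrite eq eqxx.
  rewrite /=; case: eqP => [->|_]; case: eqP => [->|_] //.
  by move=> [] /addnI/val_inj/enum_rank_inj ->.
pose cc (v : T0 + I) := match v with inl x => c (val x) | inr j => j end.
have inrP (v : T0 + I) : v \notin codom inr -> exists x, v = inl x.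
  by case: v => [x|j]; [exists x | rewrite codom_f].
have [x1 _] := mkT (fun i => if i == i1 then N else 0) ltac:(by rewrite -big_mkcond big_pred1_eq).
have [] := @scarf _ _ rk rk_inj inr cc I_gt1 _ _ _ (inl x1).
- by move=> i [x|j] /=; rewrite eqxx.
- move=> i j v nj /inrP[x ->]; rewrite [X in _ < X]/= (negbTE nj) ltnS.
  exact: leq_trans (rkx i x) (leq_addr _ _).
- by [].
- by apply/negP => /codomP[].
move=> S [/dominatedP domS cS].
(* A slack in [S] has rank 0 in its own order, so a grid point can only be dominated in an order
   from [C]. *)
pose C := [set i | inr i \notin S].
pose sg := [set x : T0 | inl x \in S].
have dom (y : T0) : exists2 i, i \in C & forall x, x \in sg -> val y i <= val x i.
  have [i hi] := domS (inl y); exists i.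
    by rewrite inE; apply/negP => /hi; rewrite /= eqxx.
  move=> x; rewrite inE => /hi; rewrite /= ltnS => h.
  have xt := ltn_ord (enum_rank x); have t_gt0 : 0 < t by apply: leq_ltn_trans xt.
  rewrite -ltnS -(ltn_pmul2r t_gt0); apply: leq_ltn_trans (leq_addr _ _) _.
  by apply: leq_ltn_trans h _; rewrite mulSn addnC ltn_add2r.
have col i : i \in C -> exists2 x, x \in sg & c (val x) = i.
  rewrite inE => iC; have : i \in cc @: S by rewrite cS inE.
  case/imsetP => -[x|j] vS ei; first by exists x; rewrite ?inE.
  by move: iC; rewrite ei /= vS.
have [i2 i2C _] := dom x1; have [x0 x0S _] := col i2 i2C.
pose u i := val [arg min_(x < x0 in sg) val x i] i : nat.
have u_le i x : x \in sg -> u i <= val x i.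
  by rewrite /u; case: arg_minnP => // y _; apply.
have u_sum : N < \sum_(i in C) (u i).+1.
  rewrite ltnNge; apply/negP => le.
  (* This grid point would exceed every minimum [u i] with [i] in [C]; the coordinate [i2] takes up
     what is missing to the total [N]. *)
  pose y i := (if i \in C then (u i).+1 else 0) + (if i == i2 then N - \sum_(i in C) (u i).+1 else 0).
  have [x hx] : exists x : T0, forall i, val x i = y i :> nat.
    by apply: mkT; rewrite big_split -!big_mkcond big_pred1_eq /= subnKC.
  have [i iC hi] := dom x.
  suff : y i <= u i by rewrite /y iC leqNgt ltn_addr.
  rewrite -hx; apply: hi.
  by case: arg_minnP.
(* Every grid point of the set lies coordinatewise above [w], whose total exceeds [N - #|I|]; so any
   two differ by at most twice [#|I|]. *)
pose w i := if i \in C then u i else 0.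
have w_le i x : x \in sg -> w i <= val x i by rewrite /w; case: ifP => // _; apply: u_le.
have sumT (x : T0) : \sum_i val x i = N by apply/eqP; apply: (valP x).
have w_sum : N < \sum_i w i + #|I|.
  rewrite /w -big_mkcond /=; apply: leq_trans u_sum _.
  under eq_bigr do rewrite -addn1.
  by rewrite big_split /= sum1_card leq_add2l max_card.
have diff x : x \in sg -> \sum_i (val x i - w i) <= #|I|.
  move=> xS; rewrite sumnB; last by move=> i _; apply: w_le.
  by rewrite sumT leq_subLR ltnW.
exists (val x0); first exact: sumT.
move=> i; have [iC|iC] := boolP (i \in C); [right | left].
  have [x xS cx] := col i iC; exists (val x); split=> //.
  apply: leq_trans (_ : \sum_j ((val x j - w j) + (val x0 j - w j)) <= _).
    by apply: leq_sum => j _; apply: leq_add; apply: leq_sub2l; apply: w_le.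
  by rewrite big_split -addnn leq_add ?diff.
by have := diff x0 x0S; rewrite (bigD1 i) //= {1}/w (negbTE iC) subn0; apply: leq_trans; rewrite leq_addr.
Qed.

(** * Hall's theorem with capacities *)

Section Hall.
Variables (A B : finType) (E : A -> B -> bool).

Definition neighbours (Y : {set A}) : {set B} := [set j | [exists i in Y, E i j]].

Lemma neighboursU (Y Z : {set A}) :
  neighbours (Y :|: Z) = neighbours Y :|: neighbours Z.
Proof.
apply/setP => j; rewrite !inE; apply/exists_inP/orP => [[i]|].
  by rewrite inE => /orP[] iY ij; [left|right]; apply/exists_inP; exists i.
by case=> /exists_inP[i iY ij]; exists i; rewrite // inE iY ?orbT.
Qed.

(** Induction on [#|X|]. If a nonempty proper part [Y] uses up the capacity of its neighbours, [Y]
    and the rest are treated separately. Otherwise every such part has a unit to spare, and any [i]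
    can be sent along an edge of positive capacity. *)
Lemma hall_capacity (b0 : B) (X : {set A}) (a : B -> nat) :
  (forall Y : {set A}, Y \subset X -> #|Y| <= \sum_(j in neighbours Y) a j) ->
  exists s : A -> B, (forall i, i \in X -> E i (s i)) /\
    forall j, #|[set i in X | s i == j]| <= a j.
Proof.
have [n] := ubnP #|X|; elim: n X a => // n IH X a; rewrite ltnS => cardX hall.
have [->|/set0Pn[i iX]] := eqVneq X set0.
  exists (fun=> b0); split=> [i|j]; first by rewrite inE.
  by rewrite (_ : [set _ in _ | _] = set0) ?cards0 //; apply/setP => i; rewrite !inE.
have [/existsP[Y /and3P[YX Y0 tight]]|/existsPn slack] :=
  boolP [exists Y : {set A}, [&& Y \proper X, Y != set0 & \sum_(j in neighbours Y) a j <= #|Y|]].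
  have sYX := proper_sub YX.
  have [||s1 [s1E s1a]] := IH Y a.
  - exact: leq_trans (proper_card YX) cardX.
  - by move=> Z ZY; apply: hall; apply: subset_trans sYX.
  pose a' j := if j \in neighbours Y then 0 else a j.
  have [||s2 [s2E s2a]] := IH (X :\: Y) a'.
  - apply: leq_trans cardX; rewrite cardsD (setIidPr sYX) ltn_subrL !card_gt0 Y0.
    by apply/set0Pn; exists i.
  - move=> Z; rewrite subsetD => /andP[ZX dZY].
    have := hall (Y :|: Z); rewrite subUset sYX ZX => /(_ isT).
    rewrite cardsU setIC (disjoint_setI0 dZY) cards0 subn0 neighboursU.
    rewrite (big_setID (neighbours Y)) /= setUK.
    rewrite setDUl setDv set0U => h.
    have := leq_trans h (leq_add tight (leqnn _)); rewrite leq_add2l => /leq_trans; apply.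
    rewrite [X in _ <= X](big_setID (neighbours Y)) /=; apply: leq_trans (leq_addl _ _).
    by apply: leq_sum => j; rewrite inE /a' => /andP[/negbTE->].
  exists (fun i => if i \in Y then s1 i else s2 i); split=> [k kX|j].
    by case: ifP => kY; [apply: s1E | apply: s2E; rewrite inE kY].
  rewrite -(cardsID Y).
  have -> : [set k in X | (if k \in Y then s1 k else s2 k) == j] :&: Y = [set k in Y | s1 k == j].
    apply/setP => k; rewrite !inE; case kY: (k \in Y); rewrite ?andbF // andbT.
    by rewrite (subsetP sYX).
  have -> : [set k in X | (if k \in Y then s1 k else s2 k) == j] :\: Y = [set k in X :\: Y | s2 k == j].
    by apply/setP => k; rewrite !inE; case kY: (k \in Y).
  have := s2a j; rewrite /a'; case: ifP => jY.
    by rewrite leqn0 => /eqP ->; rewrite addn0.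
  rewrite (_ : [set k in Y | _] = set0) ?cards0 //.
  apply/setP => k; rewrite !inE; apply/negP => /andP[kY /eqP eqj].
  by move/negP: jY; apply; rewrite inE; apply/exists_inP; exists k => //; rewrite -eqj s1E.
have /existsP[j /andP[Eij aj]] : [exists j, E i j && (0 < a j)].
  have := hall [set i]; rewrite sub1set iX cards1 => /(_ isT).
  apply: contraTT => /existsPn h; rewrite -leqNgt big1 // => j.
  rewrite inE => /exists_inP[k /set1P-> Eij]; have := h j.
  by rewrite Eij /= lt0n negbK => /eqP.
pose a' k := a k - (k == j).
have [||s [sE sa]] := IH (X :\ i) a'.
- by apply: leq_trans cardX; rewrite [X in _ < X](cardsD1 i) iX.
- move=> Z ZX; have [->|Z0] := eqVneq Z set0; first by rewrite cards0.
  have := slack Z; rewrite Z0 (sub_proper_trans ZX (properD1 iX)) /= -ltnNge => lt.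
  rewrite -ltnS; apply: leq_trans lt _.
  apply: leq_trans (_ : \sum_(k in neighbours Z) (a' k + (k == j)) <= _).
    by apply: leq_sum => k _; rewrite addnC -leq_subLR.
  rewrite big_split /= -addn1 leq_add2l.
  rewrite (eq_bigr (fun k => if k == j then 1 else 0)) // -big_mkcondr sum1_card.
  by apply: leq_trans (_ : #|[set j]| <= _); [apply/subset_leq_card/subsetP => k /andP[_]; rewrite inE | rewrite cards1].
exists (fun k => if k == i then j else s k); split=> [k kX|k].
  by case: eqP => [->//|/eqP nk]; apply: sE; rewrite !inE nk.
rewrite (cardsD1 i) inE iX eqxx /=.
have -> : [set x in X | (if x == i then j else s x) == k] :\ i = [set x in X :\ i | s x == k].
  by apply/setP => x; rewrite !inE; case: eqVneq.
have := sa k; rewrite /a' eq_sym; case: eqP => [<-|_]; last by rewrite subn0.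
by rewrite subn1 -ltnS prednK.
Qed.

(** The bounds [a j] and the actual counts have the same total, so they agree termwise. *)
Lemma hall_capacity_exact (b0 : B) (a : B -> nat) :
  (forall Y : {set A}, #|Y| <= \sum_(j in neighbours Y) a j) ->
  \sum_j a j = #|A| ->
  exists s : A -> B, (forall i, E i (s i)) /\
    forall j, #|[set i | s i == j]| = a j.
Proof.
move=> hall suma; have [|s [sE sa]] := hall_capacity b0 (X := setT) (a := a).
  by move=> Y _; apply: hall.
exists s; split=> [i|]; first exact: sE.
have sa' j : #|[set i | s i == j]| <= a j.
  by have := sa j; rewrite (_ : [set i in setT | _] = [set i | s i == j]) //; apply/setP => i; rewrite !inE.
have : \sum_j #|[set i | s i == j]| = \sum_j a j.
  rewrite suma -sum1_card (partition_big s xpredT) //=.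
  by apply: eq_bigr => j _; rewrite sum1dep_card.
move/eqP; rewrite eq_sym eqn_leq => /andP[le _] j.
apply/eqP; rewrite eqn_leq sa' //= -(leq_add2r (\sum_(k | k != j) a k)).
have <- : \sum_k a k = a j + \sum_(k | k != j) a k by rewrite (bigD1 j).
apply: leq_trans le _; rewrite (bigD1 j) //= leq_add2l.
by apply: leq_sum => k _.
Qed.
End Hall.

Local Open Scope ring_scope.

(** * Approximating prescribed proportions on a simplex *)

Definition simplex (R : numDomainType) (I : finType) (T : R) (z : I -> R) :=
  (forall i, 0 <= z i) /\ \sum_i z i = T.

(* Colour a grid point z by some i with F i z <= p i * \sum_j F j z.  Where z i is
   small this inequality holds up to eps anyway since F i z <= M * z i, so the
   alternative in [grid_colour] needs no boundary condition. *)
Lemma approx_surjective (R : archiRealFieldType) (I : finType)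
    (F : I -> (I -> R) -> R) (p : I -> R) (T M eps : R) :
  (1 < #|I|)%N -> 0 <= T -> 0 <= M -> 0 < eps ->
  (forall i, 0 <= p i) -> \sum_i p i = 1 ->
  (forall z i, simplex T z -> 0 <= F i z <= M * z i) ->
  (forall z z' i, simplex T z -> simplex T z' ->
     F i z <= F i z' + M * \sum_j `|z j - z' j|) ->
  exists2 z, simplex T z & forall i, F i z <= p i * (\sum_j F j z) + eps.
Proof.
move=> I_gt1 T0 M0 eps0 p0 p1 FM Flip.
have r0 : 0 < #|I|%:R :> R by rewrite ltr0n ltnW.
set r : R := #|I|%:R in r0 *.
(* The mesh makes the error, (1 + r) M times the l1 distance 2 r T / N.+1 of nearby grid points, at
   most [eps]. *)
have [N Nbig] : exists N : nat, (1 + r) * M * (2 * r * T) / eps < N.+1%:R.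
  have [N hN] : exists N : nat, (1 + r) * M * (2 * r * T) / eps < N%:R.
    by eexists; apply: archi_boundP; rewrite !mulr_ge0 ?invr_ge0 ?addr_ge0 // ltW.
  by exists N; apply: lt_le_trans hN _; rewrite ler_nat.
set n := N.+1 in Nbig; have n0 : 0 < n%:R :> R by rewrite ltr0n.
pose z (x : {ffun I -> 'I_n.+1}) (i : I) : R := T / n%:R * (x i)%:R.
have Tn0 : 0 <= T / n%:R by rewrite divr_ge0 // ltW.
have zS (x : {ffun I -> 'I_n.+1}) : (\sum_i x i)%N = n -> simplex T (z x).
  move=> sx; split=> [i|]; first by rewrite mulr_ge0.
  by rewrite -mulr_sumr -natr_sum sx divfK // gt_eqF.
have /card_gt0P[i1 _] := ltnW I_gt1.
(* A suitable [i] exists since the [p i] add up to 1; the default [i1] is never taken. *)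
pose c (x : {ffun I -> 'I_n.+1}) :=
  odflt i1 [pick i | F i (z x) <= p i * \sum_j F j (z x)].
have cP (x : {ffun I -> 'I_n.+1}) : F (c x) (z x) <= p (c x) * \sum_j F j (z x).
  rewrite /c; case: pickP => // h; exfalso.
  have : \sum_i p i * (\sum_j F j (z x)) < \sum_i F i (z x).
    rewrite [X in X < _](bigD1 i1) // [X in _ < X](bigD1 i1) //=.
    by apply: ltr_leD; [|apply: ler_sum => i _; apply: ltW]; rewrite ltNge h.
  by rewrite -mulr_suml p1 mul1r ltxx.
have [y sy hy] := grid_colour c I_gt1.
exists (z y); first exact: zS.
have Fy0 j : 0 <= F j (z y) by have /andP[] := FM _ j (zS y sy).
have eps_big : (1 + r) * M * (2 * r * T / n%:R) <= eps.
  move: Nbig; rewrite ltr_pdivrMr // => /ltW h.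
  by rewrite mulrA ler_pdivrMr // [eps * _]mulrC.
have q0 : 0 <= 2 * r * T / n%:R by rewrite divr_ge0 ?mulr_ge0 // ltW.
move=> i; have [yi|[x [sx <- dxy]]] := hy i.
  apply: (@le_trans _ _ eps); last by rewrite lerDr mulr_ge0 ?sumr_ge0.
  have /andP[_ /le_trans] := FM _ i (zS y sy); apply; apply: le_trans eps_big.
  rewrite [1 + r]addrC mulrDl mul1r mulrDl; apply: ler_wpDl.
    by rewrite mulr_ge0 // mulr_ge0 // ltW.
  apply: ler_wpM2l => //; rewrite /z mulrAC; apply: ler_wpM2r; first by rewrite invr_ge0 ltW.
  rewrite mulrC; apply: ler_wpM2r => //.
  apply: (@le_trans _ _ r); first by rewrite ler_nat.
  by rewrite ler_peMl ?ler1n // ltW.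
set d := \sum_j `|z x j - z y j|.
have dE : d <= 2 * r * T / n%:R.
  have -> : 2 * r * T / n%:R = T / n%:R * (#|I|.*2)%:R.
    by rewrite -mul2n natrM -/r [RHS]mulrC mulrA.
  apply: le_trans (_ : T / n%:R * (\sum_j ((x j - y j) + (y j - x j)))%N%:R <= _); last first.
    by apply: ler_wpM2l => //; rewrite ler_nat.
  rewrite natr_sum mulr_sumr; apply: ler_sum => j _.
  rewrite /z -mulrBr normrM (ger0_norm Tn0); apply: ler_wpM2l => //.
  have [le|/ltnW le] := leqP (x j) (y j).
    by rewrite distrC -natrB // normr_nat (eqP le) add0n.
  by rewrite -natrB // normr_nat [X in (_ + X)%N](eqP le) addn0.
have d0 : 0 <= d by apply: sumr_ge0.
have dC : \sum_j `|z y j - z x j| = d by apply: eq_bigr => j _; rewrite distrC.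
have Fx j : F j (z x) <= F j (z y) + M * d by apply: Flip; apply: zS.
have := Flip _ _ (c x) (zS _ sy) (zS _ sx); rewrite dC => /le_trans; apply.
have sumF : \sum_j F j (z x) <= \sum_j F j (z y) + r * (M * d).
  apply: le_trans (ler_sum _ (fun j _ => Fx j)) _.
  by rewrite big_split /= sumr_const mulr_natl.
have pc1 : p (c x) <= 1 by rewrite -p1 (bigD1 (c x)) //= lerDl sumr_ge0.
apply: le_trans (lerD (cP x) (lexx _)) _.
apply: le_trans (lerD (ler_wpM2l (p0 _) sumF) (lexx _)) _.
rewrite mulrDr -addrA lerD2l; apply: le_trans eps_big.
apply: (@le_trans _ _ (1 * (r * (M * d)) + M * d)).
  by rewrite lerD2r; apply: ler_wpM2r => //; rewrite mulr_ge0 ?mulr_ge0 // ltW.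
rewrite mul1r -[X in _ + X]mul1r -mulrDl [r + 1]addrC -mulrA.
apply: ler_wpM2l; first by rewrite addr_ge0 // ltW.
exact: ler_wpM2l.
Qed.

(** * From approximate row and column sums to an assignment *)

(** If Hall's condition fails for [Y], the rows in [Y] have all their weight in columns whose
    capacities fall short of [#|Y|] by at least 1. The row total then misses [#|A| * P] by about
    [P], whereas all errors together come to (3 #|A| + 2 #|B|) eps only. *)
Lemma transport_support (R : realFieldType) (A B : finType) (w : A -> B -> R)
    (s : A -> R) (t : B -> R) (a : B -> nat) (b0 : B) (P eps : R) :
  (forall i j, 0 <= w i j) -> (forall i, 0 <= s i) -> (forall j, 0 <= t j) ->
  (forall i, s i = 0) \/ (forall j, t j = 0) ->
  (\sum_j a j)%N = #|A| ->
  (forall i, \sum_j w i j + s i <= P + eps) ->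
  (forall j, \sum_i w i j + t j <= (a j)%:R * P + eps) ->
  \sum_i (\sum_j w i j + s i) + \sum_j (\sum_i w i j + t j) = 2 * #|A|%:R * P ->
  0 <= eps -> 3 * (#|A| + #|B|)%:R * eps < P ->
  exists f : A -> B, (forall i, 0 < w i (f i)) /\
    forall j, #|[set i | f i == j]| = a j.
Proof.
move=> w0 s0 t0 st suma rowP colP total eps0 epsP.
apply: (@hall_capacity_exact _ _ (fun i j => 0 < w i j)) => // Y.
set J := neighbours _ Y; rewrite leqNgt; apply/negP => lt.
pose W := \sum_i \sum_j w i j.
have WC : \sum_j \sum_i w i j = W by rewrite exchange_big.
pose S := \sum_i s i; pose S' := \sum_j t j.
have S0 : 0 <= S by apply: sumr_ge0.
have S'0 : 0 <= S' by apply: sumr_ge0.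
have SS' : S = 0 \/ S' = 0.
  by case: st => h; [left|right]; apply: big1.
have totalE : (W + S) + (W + S') = 2 * #|A|%:R * P.
  by rewrite -total !big_split /= WC.
have rows : W + S <= #|A|%:R * P + #|A|%:R * eps.
  rewrite -big_split /= -mulrDr mulr_natl -sumr_const; exact: ler_sum.
have cols : W + S' <= #|A|%:R * P + #|B|%:R * eps.
  rewrite -WC -big_split /= -suma natr_sum mulr_suml mulr_natl -sumr_const -big_split /=.
  exact: ler_sum.
have rowsY : W + S <= \sum_(i in Y) \sum_j w i j + S + #|~: Y|%:R * (P + eps).
  have -> : W + S = \sum_(i in Y) (\sum_j w i j + s i) + \sum_(i in ~: Y) (\sum_j w i j + s i).
    rewrite -big_split /= (bigID [in Y]) /=; congr (_ + _).
    by apply: eq_bigl => i; rewrite inE.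
  apply: lerD.
    rewrite big_split lerD2l /S [leRHS](bigID [in Y]) /= lerDl; exact: sumr_ge0.
  rewrite mulr_natl -sumr_const; exact: ler_sum.
have colsY : \sum_(i in Y) \sum_j w i j <= (\sum_(j in J) a j)%N%:R * P + #|B|%:R * eps.
  have -> : \sum_(i in Y) \sum_j w i j = \sum_(i in Y) \sum_(j in J) w i j.
    apply: eq_bigr => i iY; rewrite [LHS](bigID [in J]) /= [X in _ + X]big1 ?addr0 // => j jJ.
    apply/eqP; rewrite eq_le w0 andbT leNgt; apply: contra jJ => wij.
    by rewrite inE; apply/exists_inP; exists i.
  rewrite exchange_big /=.
  apply: le_trans (_ : \sum_(j in J) ((a j)%:R * P + eps) <= _).
    apply: ler_sum => j _; apply: le_trans (colP j).
    rewrite [X in _ <= X + _](bigID [in Y]) /= -addrA lerDl addr_ge0 ?sumr_ge0 //.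
  rewrite big_split /= natr_sum -mulr_suml lerD2l sumr_const -[eps *+ _]mulr_natl ler_wpM2r //.
  by rewrite ler_nat max_card.
(* When [S'] is 0, the total gives W = #|A| P - S / 2, and [rows] then bounds [S]. *)
have SE : S <= 2 * #|A|%:R * eps.
  have ? : 0 <= #|A|%:R * eps by rewrite mulr_ge0.
  case: SS' => [->|S'E]; first by lra.
  by rewrite S'E in totalE cols; lra.
have cY : #|Y|%:R + #|~: Y|%:R = #|A|%:R :> R by rewrite -natrD cardsC.
have ltR : (\sum_(j in J) a j)%N%:R + 1 <= #|Y|%:R :> R by rewrite natr1 ler_nat.
have P0 : 0 < P by apply: le_lt_trans epsP; rewrite !mulr_ge0.
have ltP : ((\sum_(j in J) a j)%N%:R + 1) * P <= #|Y|%:R * P by rewrite ler_wpM2r // ltW.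
have ltE : #|~: Y|%:R * eps <= #|A|%:R * eps by rewrite ler_wpM2r // ler_nat max_card.
have cP : #|Y|%:R * P + #|~: Y|%:R * P = #|A|%:R * P by rewrite -mulrDl cY.
have ? : 0 <= #|B|%:R * eps by rewrite mulr_ge0.
have ? : 0 <= #|A|%:R * eps by rewrite mulr_ge0.
rewrite natrD in epsP; clear suma lt.
lra.
Qed.

(** * Cutting an interval into consecutive strips *)

Section Strips.
Variables (R : realFieldType) (d : nat) (B delta : R).
Implicit Types (z : 'I_d.+1 -> R) (i : 'I_d.+1).

Definition left_end z (i : 'I_d.+1) := - B + \sum_(k : 'I_d.+1 | (k < i)%N) z k.
Definition right_end z (i : 'I_d.+1) := left_end z i + z i.

(* Positive iff ]lo, hi[ lies in the i-th strip enlarged by delta on both sides;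
   a delta smaller than all gaps between endpoints makes this exact. *)
Definition clearance z i lo hi :=
  Num.min (lo - left_end z i + delta) (right_end z i - hi + delta).

Lemma clearance_gt0 z i lo hi : 0 < clearance z i lo hi ->
  left_end z i < lo + delta /\ hi < right_end z i + delta.
Proof. by rewrite /clearance lt_min => /andP[]; lra. Qed.

(** The two arguments of the minimum add up to at most [z i]. Thus nothing has positive clearance in
    a strip of width 0. *)
Lemma clearance_le z i lo hi :
  0 <= z i -> 2 * delta <= hi - lo -> clearance z i lo hi <= z i.
Proof.
move=> zi gap; rewrite /clearance /right_end ge_min; apply/orP.
by have [?|?] := lerP (lo - left_end z i + delta) (z i); [left | right; lra].
Qed.

Lemma clearance_lip z z' i lo hi :
  clearance z i lo hi <= clearance z' i lo hi + \sum_k `|z k - z' k|.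
Proof.
have close (u v : 'I_d.+1 -> R) : left_end u i - left_end v i + `|u i - v i| <= \sum_k `|u k - v k|.
  rewrite (bigID (fun k : 'I_d.+1 => (k < i)%N)) /= /left_end.
  rewrite [X in _ <= _ + X](bigD1 i) ?ltnn //= [- B + _]addrC addrKA -sumrB.
  set s1 := \sum_(k | _) _; set s2 := \sum_(k | _) _; set s3 := \sum_(k | _) _.
  have : s1 <= s2 by apply: ler_sum => k _; apply: ler_norm.
  have : 0 <= s3 by apply: sumr_ge0.
  by lra.
have := close z z'; have := close z' z.
have -> : \sum_k `|z' k - z k| = \sum_k `|z k - z' k|.
  by apply: eq_bigr => k _; rewrite distrC.
set D := \sum_k _ => h1 h2.
have := ler_norm (z i - z' i); have := normr_ge0 (z i - z' i); have := normr_ge0 (z' i - z i).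
rewrite /clearance -lerBlDr le_min => ? ? ?; rewrite !lerBlDr !ge_min /right_end.
by apply/andP; split; apply/orP; [left|right]; lra.
Qed.

(** The tolerances allow only an overlap of less than 2 delta, which the gap hypothesis excludes. *)
Lemma strips_separate z i i' lo hi lo' hi' : (forall k, 0 <= z k) ->
  (lo' < hi -> 2 * delta <= hi - lo') -> (i < i')%N ->
  0 < clearance z i lo hi -> 0 < clearance z i' lo' hi' -> hi <= lo'.
Proof.
move=> z0 gap lt /clearance_gt0[_ h] /clearance_gt0[h' _].
have le : right_end z i <= left_end z i'.
  rewrite /right_end /left_end -addrA lerD2l [leRHS](bigID (fun k : 'I_d.+1 => (k < i)%N)) /=.
  rewrite [X in _ <= X + _](eq_bigl (fun k : 'I_d.+1 => (k < i)%N)); last first.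
    by move=> k; rewrite andbC; case: ltnP => // ki; rewrite (ltn_trans ki).
  by rewrite lerD2l (bigD1 i) ?ltnn ?lt //= lerDl sumr_ge0.
by rewrite leNgt; apply/negP => /gap; lra.
Qed.

(** The first strip whose right end reaches [hi] works: the previous right end does not reach it, so
    it is at most [lo]. The last strip qualifies because the strips extend at least to [B]. *)
Lemma strip_exists z lo hi : 0 <= delta -> - B <= lo -> lo < hi -> hi <= B ->
  2 * B <= \sum_k z k ->
  (forall j : 'I_d, right_end z (widen_ord (leqnSn d) j) <= lo \/
                    hi <= right_end z (widen_ord (leqnSn d) j)) ->
  exists i, delta <= clearance z i lo hi.
Proof.
move=> delta0 lo_ge lohi hi_le sum_ge miss.
have endR : right_end z ord_max = - B + \sum_k z k.
  rewrite /right_end /left_end -addrA; congr (_ + _).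
  rewrite [RHS](bigD1 ord_max) //= addrC; congr (_ + _); apply: eq_bigl => k.
  by rewrite -val_eqE /= ltn_neqAle -ltnS ltn_ord andbT.
have hmax : hi <= right_end z ord_max by rewrite endR; lra.
have [i hi_i imin] := @arg_minnP _ ord_max (fun i => hi <= right_end z i) (fun i => i : nat) hmax.
exists i; rewrite /clearance le_min; apply/andP; split; last by lra.
suff : left_end z i <= lo by lra.
case: i hi_i imin => -[|k] ik hi_i imin.
  by rewrite /left_end big_pred0 ?addr0.
have kd : (k < d)%N by [].
have -> : left_end z (Ordinal ik) = right_end z (widen_ord (leqnSn d) (Ordinal kd)).
  rewrite /right_end /left_end -addrA; congr (_ + _).
  rewrite (bigD1 (widen_ord (leqnSn d) (Ordinal kd))) //= addrC; congr (_ + _).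
  by apply: eq_bigl => l; rewrite -val_eqE /= ltnS ltn_neqAle andbC.
case: (miss (Ordinal kd)) => // /imin /=.
by rewrite ltnn.
Qed.
End Strips.

(** * The positive part of a minimum *)

Section Truncation.
Variable R : realFieldType.
Implicit Types x y : R.

Definition trunc x y := Num.max 0 (Num.min x y).

Lemma trunc_ge0 x y : 0 <= trunc x y.
Proof. by rewrite le_max lexx. Qed.

Lemma trunc_le x y c : 0 <= c -> x <= c -> trunc x y <= c.
Proof. by move=> c0 xc; rewrite ge_max c0 ge_min xc. Qed.

Lemma le_trunc x y c : c <= x -> c <= y -> c <= trunc x y.
Proof. by move=> cx cy; rewrite le_max le_min cx cy orbT. Qed.

Lemma trunc_gt0 x y : 0 < trunc x y -> 0 < x /\ 0 < y.
Proof. by rewrite lt_max ltxx lt_min => /andP. Qed.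

Lemma trunc_lip x y x' y' D : 0 <= D -> x <= x' + D -> y <= y' + D ->
  trunc x y <= trunc x' y' + D.
Proof.
move=> D0 xx yy; rewrite ge_max addr_ge0 ?trunc_ge0 //= -lerBlDr le_max le_min.
have [le|/ltW le] := leP x y.
  by apply/orP; right; lra.
by apply/orP; right; lra.
Qed.
End Truncation.

(** * The theorem for open rectangles *)

Lemma exists_gap (R : realFieldType) (K : finType) (u : K -> R) :
  exists2 delta, 0 < delta & forall k, 0 < u k -> delta <= u k.
Proof.
exists (\big[Num.min/1]_(k | 0 < u k) u k).
  by elim/big_ind: _ => // x y x0 y0; rewrite lt_min x0 y0.
by move=> k uk; rewrite (bigD1 k) //= ge_min lexx.
Qed.

Theorem rectangles (R : archiRealFieldType) (K : finType) (m n : nat)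
    (xl xr yl yr : K -> R) :
  (forall k, xl k < xr k) -> (forall k, yl k < yr k) ->
  (forall (Y : 'I_m -> R) (X : 'I_n -> R), exists k,
     (forall i, Y i <= yl k \/ yr k <= Y i) /\
     (forall j, X j <= xl k \/ xr k <= X j)) ->
  forall a : 'I_n.+1 -> nat, (\sum_j a j)%N = m.+1 ->
  exists (f : 'I_m.+1 -> K) (s : 'I_m.+1 -> 'I_n.+1),
    [/\ forall j, #|[set i | s i == j]| = a j,
        forall i i' : 'I_m.+1, (i < i')%N -> yr (f i) <= yl (f i') &
        forall i i' : 'I_m.+1, (s i < s i')%N -> xr (f i) <= xl (f i')].
Proof.
move=> xlr ylr nocut a suma.
have [dx dx0 gapx] := exists_gap (fun kk : K * K => xr kk.1 - xl kk.2).
have [dy dy0 gapy] := exists_gap (fun kk : K * K => yr kk.1 - yl kk.2).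
(* At most half of every positive difference of a right and a left end; the bound 1 ensures
   [delta <= B]. *)
pose delta := Num.min 1 (Num.min dx dy / 2).
have delta0 : 0 < delta by rewrite lt_min ltr01 divr_gt0 // lt_min dx0.
have delta1 : delta <= 1 by rewrite ge_min lexx.
have deltam : 2 * delta <= Num.min dx dy.
  by rewrite mulrC -ler_pdivlMr // /delta ge_min lexx orbT.
have {}gapx k k' : xl k' < xr k -> 2 * delta <= xr k - xl k'.
  rewrite -subr_gt0 => /(gapx (k, k')); apply: le_trans.
  by apply: le_trans deltam _; rewrite ge_min lexx.
have {}gapy k k' : yl k' < yr k -> 2 * delta <= yr k - yl k'.
  rewrite -subr_gt0 => /(gapy (k, k')); apply: le_trans.
  by apply: le_trans deltam _; rewrite ge_min lexx orbT.
pose B := 1 + \sum_k (`|xl k| + `|xr k| + `|yl k| + `|yr k|).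
have B1 : 1 <= B by rewrite lerDl sumr_ge0 // => k _; rewrite !addr_ge0.
have bound k : [/\ - B <= xl k, xr k <= B, - B <= yl k & yr k <= B].
  have : `|xl k| + `|xr k| + `|yl k| + `|yr k| <= B.
    rewrite /B (bigD1 k) //=; set s := \sum_(_ | _) _.
    have : 0 <= s by apply: sumr_ge0 => k' _; rewrite !addr_ge0.
    by lra.
  have := ler_norm (- xl k); have := ler_norm (xr k); have := ler_norm (- yl k); have := ler_norm (yr k).
  have := normr_ge0 (xl k); have := normr_ge0 (xr k); have := normr_ge0 (yl k); have := normr_ge0 (yr k).
  by rewrite !normrN; split; lra.
pose I := ('I_m.+1 + 'I_n.+1)%type.
pose zy (z : I -> R) i := z (inl i); pose zx (z : I -> R) j := z (inr j).
pose cy (z : I -> R) i k := clearance B delta (zy z) i (yl k) (yr k).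
pose cx (z : I -> R) j k := clearance B delta (zx z) j (xl k) (xr k).
pose w (z : I -> R) i j := \sum_k trunc (cy z i k) (cx z j k).
(* The coordinates z range over one simplex rather than a product of two, so the
   total width in one direction may be too small to cover all rectangles.  There
   sy, resp. sx, keeps F from vanishing; they are never nonzero simultaneously. *)
pose sy (z : I -> R) i := trunc (z (inl i)) (3 * B - \sum_j zx z j).
pose sx (z : I -> R) j := trunc (z (inr j)) (3 * B - \sum_i zy z i).
pose F (u : I) (z : I -> R) := match u with
  | inl i => \sum_j w z i j + sy z i
  | inr j => \sum_i w z i j + sx z j end.
have w0 z i j : 0 <= w z i j by apply: sumr_ge0 => k _; apply: trunc_ge0.
have sy0 z i : 0 <= sy z i by apply: trunc_ge0.
have sx0 z j : 0 <= sx z j by apply: trunc_ge0.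
have F0 u z : 0 <= F u z by case: u => u /=; rewrite addr_ge0 ?sumr_ge0.
have cardI : #|{: I}| = (m.+1 + n.+1)%N by rewrite card_sum !card_ord.
pose r : R := #|{: I}|%:R.
have r1 : 1 <= r by rewrite /r cardI ler1n.
pose T := 2 * B * (r + 4).
pose M : R := r * #|K|%:R + 1.
pose q : R := 2 * m.+1%:R.
have q0 : 0 < q by rewrite mulr_gt0.
pose p (u : I) : R := match u with inl _ => 1 / q | inr j => (a j)%:R / q end.
(* Chosen to make 3 r eps less than [delta / q], a lower bound for [P]. *)
pose eps := delta / (4 * q * r).
have eps0 : 0 < eps by rewrite divr_gt0 // !mulr_gt0 //; lra.
have sumz z : \sum_u z u = \sum_i zy z i + \sum_j zx z j :> R by rewrite big_sumType.
have w_le z i j c : 0 <= c -> (forall k, cy z i k <= c \/ cx z j k <= c) -> w z i j <= #|K|%:R * c.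
  move=> c0 h; rewrite mulr_natl -sumr_const; apply: ler_sum => k _.
  by rewrite ge_max c0 /= ge_min; case: (h k) => ->; rewrite ?orbT.
have mn_le : m.+1%:R <= r /\ n.+1%:R <= r :> R.
  by rewrite /r cardI !ler_nat leq_addr leq_addl.
have w_sum (y : R) (N : nat) : N%:R <= r -> 0 <= y -> N%:R * (#|K|%:R * y) <= r * #|K|%:R * y.
  by move=> Nr y0; rewrite -mulrA; apply: ler_wpM2r => //; rewrite mulr_ge0.
have F_le z u : simplex T z -> F u z <= M * z u.
  move=> [z0 _]; rewrite /M mulrDl mul1r; case: u => [i|j] /=; apply: lerD.
  - apply: le_trans (w_sum _ n.+1 _ (z0 _)); last by case: mn_le.
    rewrite -[X in X%:R * _]card_ord mulr_natl -sumr_const; apply: ler_sum => j _.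
    by apply: w_le => // k; left; apply: clearance_le; [apply: z0 | apply: gapy].
  - exact: trunc_le.
  - apply: le_trans (w_sum _ m.+1 _ (z0 _)); last by case: mn_le.
    rewrite -[X in X%:R * _]card_ord mulr_natl -sumr_const; apply: ler_sum => i _.
    by apply: w_le => // k; right; apply: clearance_le; [apply: z0 | apply: gapx].
  - exact: trunc_le.
have F_lip z z' u : F u z <= F u z' + M * \sum_v `|z v - z' v|.
  set D := \sum_v _.
  have Dy : \sum_i `|zy z i - zy z' i| <= D by rewrite /D big_sumType lerDl sumr_ge0.
  have Dx : \sum_j `|zx z j - zx z' j| <= D by rewrite /D big_sumType lerDr sumr_ge0.
  have D0 : 0 <= D by apply: sumr_ge0.
  have zD v : z v <= z' v + D.
    by rewrite -lerBlDl; apply: le_trans (ler_norm _) _; rewrite /D (bigD1 v) //= lerDl sumr_ge0.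
  have cyD i k : cy z i k <= cy z' i k + D.
    by apply: le_trans (clearance_lip _ _ _ (zy z') _ _ _) _; rewrite lerD2l.
  have cxD j k : cx z j k <= cx z' j k + D.
    by apply: le_trans (clearance_lip _ _ _ (zx z') _ _ _) _; rewrite lerD2l.
  have wD i j : w z i j <= w z' i j + #|K|%:R * D.
    rewrite mulr_natl -sumr_const -big_split; apply: ler_sum => k _.
    exact: trunc_lip.
  have sumD (J : finType) (g g' : J -> R) : \sum_l `|g l - g' l| <= D -> - \sum_l g l <= - \sum_l g' l + D.
    move=> gD; rewrite lerNl opprD opprK lerBlDr -lerBlDl -sumrB; apply: le_trans gD.
    by apply: ler_sum => l _; rewrite distrC; apply: ler_norm.
  rewrite /M mulrDl mul1r; case: u => [i|j] /=; rewrite addrACA; apply: lerD.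
  - apply: le_trans (lerD (lexx _) (w_sum _ n.+1 _ D0)); last by case: mn_le.
    rewrite -[X in X%:R * _]card_ord mulr_natl -sumr_const -big_split; apply: ler_sum => j _.
    exact: wD.
  - by apply: trunc_lip => //; rewrite -addrA lerD2l; apply: sumD.
  - apply: le_trans (lerD (lexx _) (w_sum _ m.+1 _ D0)); last by case: mn_le.
    rewrite -[X in X%:R * _]card_ord mulr_natl -sumr_const -big_split; apply: ler_sum => i _.
    exact: wD.
  - by apply: trunc_lip => //; rewrite -addrA lerD2l; apply: sumD.
have [z zS zP] : exists2 z, simplex T z & forall u, F u z <= p u * (\sum_v F v z) + eps.
  apply: (@approx_surjective _ _ F p T M eps) => //.
  - by rewrite cardI addSnnS ltn_addl.
  - by rewrite !mulr_ge0 //; lra.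
  - by rewrite addr_ge0 // mulr_ge0 //; lra.
  - by case=> u /=; rewrite divr_ge0 // ltW.
  - rewrite big_sumType /= -!mulr_suml -natr_sum suma sumr_const card_ord -mulrDl.
    by rewrite /q -mulr2n mulr_natl divff // mulrn_eq0 pnatr_eq0.
  - by move=> z u zS; rewrite F0 F_le.
have [z0 zT] := zS; rewrite sumz in zT.
(* If both directions cover the range from -B to B, a rectangle missed by the dividing lines, which
   are the right ends of all strips but the last, has clearance [delta] in some cell. Otherwise the
   other direction has a wide strip, whose slack term is at least [delta]. *)
have G_ge : delta <= \sum_v F v z.
  suff [u hu] : exists u, delta <= F u z.
    by rewrite (bigD1 u) //=; apply: ler_wpDr => //; apply: sumr_ge0.
  have big_coord (J : finType) (j0 : J) (g : J -> R) : #|J|%:R <= r -> B * r <= \sum_j g j ->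
      exists j, B <= g j.
    move=> Jr sum_ge; apply/existsP; apply: contraTT sum_ge => /existsPn h.
    rewrite -ltNge; apply: (@lt_le_trans _ _ (\sum_(j : J) B)).
      rewrite (bigD1 j0) // [ltRHS](bigD1 j0) //=.
      by apply: ltr_leD; [|apply: ler_sum => j _; apply: ltW]; rewrite ltNge h.
    by rewrite sumr_const -mulr_natl mulrC ler_wpM2l //; lra.
  have Br : B * r + 2 * B <= T - 2 * B.
    have : 0 <= B * r by rewrite mulr_ge0 //; lra.
    by rewrite /T; lra.
  have [xbig|xsmall] := lerP (2 * B) (\sum_j zx z j); last first.
    have [||i hi] := big_coord _ ord0 (zy z).
    - by rewrite card_ord; case: mn_le.
    - by lra.
    exists (inl i); apply: ler_wpDl; first exact: sumr_ge0.
    by apply: le_trunc; move: hi; rewrite /zy; lra.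
  have [ybig|ysmall] := lerP (2 * B) (\sum_i zy z i); last first.
    have [||j hj] := big_coord _ ord0 (zx z).
    - by rewrite card_ord; case: mn_le.
    - by lra.
    exists (inr j); apply: ler_wpDl; first exact: sumr_ge0.
    by apply: le_trunc; move: hj; rewrite /zx; lra.
  have [k [hY hX]] := nocut (fun i => right_end B (zy z) (widen_ord (leqnSn m) i))
                            (fun j => right_end B (zx z) (widen_ord (leqnSn n) j)).
  have [lx rx ly ry] := bound k.
  have [i hi] := strip_exists (ltW delta0) ly (ylr k) ry ybig hY.
  have [j hj] := strip_exists (ltW delta0) lx (xlr k) rx xbig hX.
  exists (inl i); apply: ler_wpDr => //.
  rewrite (bigD1 j) //=; apply: ler_wpDr; first exact: sumr_ge0.
  rewrite /w (bigD1 k) //=; apply: ler_wpDr; first by apply: sumr_ge0 => *; apply: trunc_ge0.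
  exact: le_trunc.
pose P := (\sum_v F v z) / q.
have P_ge : delta / q <= P by rewrite ler_pM2r ?invr_gt0.
have [||||||||||s [sw sa]] := @transport_support _ _ _ (w z) (sy z) (sx z) a ord0 P eps.
- by [].
- by [].
- by [].
- have [xb|xs] := lerP (3 * B) (\sum_j zx z j).
    left => i; apply/eqP; rewrite eq_le sy0 andbT /sy /trunc ge_max lexx ge_min /=.
    by apply/orP; right; lra.
  right => j; apply/eqP; rewrite eq_le sx0 andbT /sx /trunc ge_max lexx ge_min /=.
  apply/orP; right; have : 6 * B <= T.
    rewrite /T -mulrA [B * _]mulrC mulrA ler_wpM2r //; lra.
  by lra.
- by rewrite suma card_ord.
- by move=> i; apply: le_trans (zP (inl i)) _; rewrite /= /P mul1r mulrC.
- by move=> j; apply: le_trans (zP (inr j)) _; rewrite /= /P mulrAC mulrA.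
- rewrite card_ord -/q /P mulrC divfK ?gt_eqF // big_sumType //=.
- exact: ltW.
- rewrite !card_ord -cardI -/r; apply: lt_le_trans P_ge.
  have -> : 3 * r * eps = 3 / 4 * (delta / q).
    by rewrite /eps; field; rewrite !gt_eqF //; lra.
  have : 0 < delta / q by rewrite divr_gt0.
  by lra.
have [f fP] : exists f : 'I_m.+1 -> K, forall i, 0 < trunc (cy z i (f i)) (cx z (s i) (f i)).
  apply: (@fin_all_exists _ (fun=> K) (fun i k => 0 < trunc (cy z i k) (cx z (s i) k))) => i.
  apply/existsP; apply: contraTT (sw i) => /existsPn h.
  by rewrite -leNgt /w; apply: sumr_le0 => k _; rewrite leNgt h.
exists f, s; split=> // i i' lt.
  have [hi _] := trunc_gt0 (fP i); have [hi' _] := trunc_gt0 (fP i').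
  by apply: strips_separate lt hi hi'; [move=> k; apply: z0 | apply: gapy].
have [_ hi] := trunc_gt0 (fP i); have [_ hi'] := trunc_gt0 (fP i').
by apply: strips_separate lt hi hi'; [move=> k; apply: z0 | apply: gapx].
Qed.

From mathcomp Require Import all_classical all_reals all_analysis.
Import numFieldNormedType.Exports.

Local Open Scope classical_set_scope.
Local Open Scope ring_scope.

(** * Projections of connected bounded open sets *)

(** The image is a bounded interval and open, so it equals its interior, which runs from its infimum
    to its supremum. *)
Lemma projection_interval (R : realType) (pr : R * R -> R) (X : set (R * R)) :
  continuous pr -> (forall A, open A -> open (pr @` A)) ->
  (forall p, `|pr p| <= `|p|) -> connected_bounded_open X ->
  exists lo hi, lo < hi /\ pr @` X = [set r | lo < r < hi].
Proof.
move=> pr_cont pr_open pr_le [[p0 Xp0] Xconn Xbnd Xopen].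
have [M [_ HM]] := Xbnd.
have Mb r : (pr @` X) r -> `|r| <= M + 1.
  move=> [p Xp <-]; apply: le_trans (pr_le p) _.
  by apply: (HM (M + 1)) => //; rewrite ltrDl.
have XE : pr @` X = [set r | inf (pr @` X) < r < sup (pr @` X)].
  rewrite -interval_bounded_interior.
  - exact/esym/interior_id/pr_open.
  - apply/connected_intervalP/connected_continuous_connected => //.
    exact: continuous_subspaceT.
  - by exists (- (M + 1)) => r /Mb; rewrite ler_norml => /andP[].
  - by exists (M + 1) => r /Mb; rewrite ler_norml => /andP[].
exists (inf (pr @` X)), (sup (pr @` X)); split=> //.
have : (pr @` X) (pr p0) by exists p0.
by rewrite {1}XE /= => /andP[]; apply: lt_trans.
Qed.

Lemma fst_open (R : realType) (A : set (R * R)) : open A -> open (fst @` A).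
Proof.
rewrite !openE => Aopen _ [[x y] Axy <-] /=.
have /nbhs_ballP[e e0 he] := Aopen _ Axy.
apply/nbhs_ballP; exists e => // x' hx'; exists (x', y) => //.
by apply: he; split=> //=; apply: ballxx.
Qed.

Lemma snd_open (R : realType) (A : set (R * R)) : open A -> open (snd @` A).
Proof.
rewrite !openE => Aopen _ [[x y] Axy <-] /=.
have /nbhs_ballP[e e0 he] := Aopen _ Axy.
apply/nbhs_ballP; exists e => // y' hy'; exists (x, y') => //.
by apply: he; split=> //=; apply: ballxx.
Qed.

Lemma fst_interval (R : realType) (X : set (R * R)) : connected_bounded_open X ->
  exists lo hi, lo < hi /\ fst @` X = [set r | lo < r < hi].
Proof.
apply: projection_interval.
- by move=> p; apply: cvg_fst.
- exact: fst_open.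
- by move=> p; rewrite [leRHS]prod_normE le_max lexx.
Qed.

Lemma snd_interval (R : realType) (X : set (R * R)) : connected_bounded_open X ->
  exists lo hi, lo < hi /\ snd @` X = [set r | lo < r < hi].
Proof.
apply: projection_interval.
- by move=> p; apply: cvg_snd.
- exact: snd_open.
- by move=> p; rewrite [leRHS]prod_normE le_max lexx orbT.
Qed.

(** * Families with an exact number of distinct lines *)

Lemma extend_uniq (R : realDomainType) (m : nat) (s : seq R) :
  uniq s -> (size s <= m)%N ->
  exists s', [/\ uniq s', size s' = m & {subset s <= s'}].
Proof.
have [k] := ubnP (m - size s); elim: k s => // k IH s; rewrite ltnS => mk us sm.
have [eqm|nm] := eqVneq (size s) m; first by exists s; split.
have lt : (size s < m)%N by rewrite ltn_neqAle nm.
(* A new entry: it exceeds the absolute values of all old ones. *)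
pose x := 1 + \sum_(y <- s) `|y|.
have xs : x \notin s.
  apply/negP => xs; have : x <= \sum_(y <- s) `|y|.
    rewrite (big_rem x) //= ; apply: le_trans (ler_norm x) _.
    by rewrite lerDl sumr_ge0.
  by rewrite /x -lerBrDr subrr ler10.
have [|||s' [us' ss' sub]] := IH (x :: s).
- by move=> /=; lia.
- by rewrite /= xs.
- by [].
by exists s'; split=> // y ys; apply: sub; rewrite inE ys orbT.
Qed.

(** The coordinates [f i] may repeat, so duplicates are dropped and new ones added up to exactly
    [m]. *)
Lemma pad_lines (R : realType) (m : nat) (line : R -> set (R * R)) (f : 'I_m -> R) :
  injective line ->
  exists H : set (set (R * R)),
    [/\ (H #= `I_m)%card, forall l, H l -> exists c, l = line c & forall i, H (line (f i))].
Proof.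
move=> line_inj; have [||s [us sm sub]] := @extend_uniq R m (undup (codom f)).
- exact: undup_uniq.
- by apply: leq_trans (size_undup _) _; rewrite size_codom card_ord.
exists ((fun i => line (nth 0 s i)) @` `I_m); split.
- apply: inj_card_eq => i j /set_mem /= im /set_mem /= jm /line_inj/eqP.
  by rewrite nth_uniq ?sm // => /eqP.
- by move=> _ [i _ <-]; eexists.
move=> i; have fs : f i \in s by apply: sub; rewrite mem_undup codom_f.
by exists (index (f i) s); rewrite /= -?sm ?index_mem // nth_index.
Qed.

(** * From rectangles back to connected sets *)

Theorem corollary4 (R : realType) (F : set (set (R * R))) (n m : nat)
    (Ffin : finite_set F)
    (Fcbo : forall X : set (R * R), F X -> connected_bounded_open X)
    (n_gt0 : (0 < n)%N) (le_nm : (n <= m)%N) :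
  (exists L : set (set (R * R)), lines_family m n L /\ cuts L F) \/
  (forall a : 'I_n.+1 -> nat,
     (forall i, (0 < a i)%N) -> (\sum_(i < n.+1) a i)%N = m.+1 ->
   exists (X : 'I_m.+1 -> set (R * R)) (sigma : 'I_m.+1 -> 'I_n.+1),
     [/\ injective X /\ (forall i, F (X i)),
         forall i : 'I_n.+1, #|[pred j | sigma j == i]| = a i,
         forall i j : 'I_m.+1, i != j ->
           (snd @` X i) `&` (snd @` X j) = set0
       & forall i j : 'I_m.+1, sigma i != sigma j ->
           (fst @` X i) `&` (fst @` X j) = set0]).
Proof.
have /finite_seqP[s Fs] := Ffin.
pose X (k : 'I_(size s)) := nth set0 s k.
have FX k : F (X k) by rewrite Fs /= mem_nth.
have [xl xlP] := choice (fun k => fst_interval (Fcbo _ (FX k))).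
have [xr xP] := choice xlP.
have [yl ylP] := choice (fun k => snd_interval (Fcbo _ (FX k))).
have [yr yP] := choice ylP.
(* Lines are given by coordinates, possibly repeated; a line misses [X k] exactly when its
   coordinate lies outside the open interval onto which [X k] projects. *)
have [nocut|] := pselect (forall (Y : 'I_m -> R) (Z : 'I_n -> R), exists k,
    (forall i, Y i <= yl k \/ yr k <= Y i) /\
    (forall j, Z j <= xl k \/ xr k <= Z j)).
  right => a _ suma.
  have [f [sg [sga fy fx]]] := rectangles (fun k => (xP k).1) (fun k => (yP k).1) nocut suma.
  have disj_y (i j : 'I_m.+1) : i != j -> (snd @` X (f i)) `&` (snd @` X (f j)) = set0.
    move=> ne; rewrite -subset0 => r; rewrite (yP (f i)).2 (yP (f j)).2 /= => -[].
    move=> /andP[? ?] /andP[? ?]; have [/fy|/fy|/val_inj/eqP] := ltngtP i j.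
    - by lra.
    - by lra.
    - by rewrite (negbTE ne).
  exists (X \o f), sg; split.
  - split=> [i j /= eqX|i]; last exact: FX.
    (* Equal sets at distinct indices would have a nonempty projection disjoint from itself. *)
    apply/eqP; apply: contraT => /disj_y; rewrite -eqX setIid => e.
    have [[p Xp] _ _ _] := Fcbo _ (FX (f i)).
    by have : (snd @` X (f i)) p.2 by [exists p]; rewrite e.
  - by move=> j; rewrite -(sga j) cardsE.
  - exact: disj_y.
  move=> i j ne; rewrite -subset0 => r; rewrite (xP (f i)).2 (xP (f j)).2 /= => -[].
  move=> /andP[? ?] /andP[? ?]; have [/fx|/fx|/val_inj/eqP] := ltngtP (sg i) (sg j).
  - by lra.
  - by lra.
  - by rewrite (negbTE ne).
move/existsNP => [Y /existsNP[Z /forallNP YZ]]; left.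
have [H [cardH H_lines YH]] := @pad_lines R m (fun c => [set p | p.2 = c]) Y
  ltac:(by move=> c c' /seteqP[/(_ (0, c)) h _]; apply: h).
have [V [cardV V_lines ZV]] := @pad_lines R n (fun c => [set p | p.1 = c]) Z
  ltac:(by move=> c c' /seteqP[/(_ (c, 0)) h _]; apply: h).
exists (H `|` V); split; first by exists H, V.
move=> A; rewrite Fs => /= /(nthP set0)[k ks <-].
have := YZ (Ordinal ks).
move=> /not_andP[] /existsNP[i /not_orP[/negP + /negP]]; rewrite -!ltNge => lo hi.
  exists [set p | p.2 = Y i]; first by left; apply: YH.
  have : (snd @` X (Ordinal ks)) (Y i) by rewrite (yP _).2 /= lo.
  by move=> [p Xp <-]; exists p.
exists [set p | p.1 = Z i]; first by right; apply: ZV.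
have : (fst @` X (Ordinal ks)) (Z i) by rewrite (xP _).2 /= lo.
by move=> [p Xp <-]; exists p.
Qed.
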